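(* Fix an admissible $k_0$ with $K_{ff}(k_0,0)$ invertible, and suppose the wedges $z_b|_P\wedge w_b|_P$, $b=1,\dots,n_b$, formed at $(k_0,0)$, span $\Lambda^2\mathbb{R}^p$. Then $F:a\mapsto\Pi_{\mathcal{A}_P}R(k_0,a)$ is a submersion at $a=0$ with $F(0)=0$, so the image of every neighbourhood of $a=0$ contains a neighbourhood of $0$ in $\mathcal{A}_P$. That is, every antisymmetric shared block (element of $\mathcal{A}_P$) of sufficiently small norm is realised exactly as $\Pi_{\mathcal{A}_P}R(k_0,a)$, at $k=k_0$ unchanged, by some odd-coupling vector $a$ near $0$, which may be supported on any $p(p-1)/2$ bonds whose wedges are linearly independent. If in addition $\operatorname{rank}\partial R/\partial(k,a)=m_Tm_S$ at $(k_0,0)$, which holds in particular when $\operatorname{rank}\partial R/\partial k=m_Tm_S-p(p-1)/2$ at $k_0$ (with $a=0$), then $R$ itself is a submersion at $(k_0,0)$ and the image of every neighbourhood of $(k_0,0)$ contains a neighbourhood of $R(k_0,0)$ in $\mathbb{R}^{m_T\times m_S}$; every target sufficiently close to $R(k_0,0)$ is reached exactly.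
   Context: Network: $N$ point nodes at positions $x_i\in\mathbb{R}^2$ are joined by $n_b$ bonds. For a bond $b=(i,j)$ of length $L_b=|x_j-x_i|>0$ let $\hat n_b=(x_j-x_i)/L_b$ and let $\hat t_b$ be $\hat n_b$ rotated by $+90^\circ$. The vector $q_b\in\mathbb{R}^{2N}$ carries $-\hat n_b$ at node $i$, $+\hat n_b$ at node $j$, zeros elsewhere; $s_b$ is the same with $\hat t_b$. For stiffnesses $k=(k_b)$ and odd couplings $a=(a_b)\in\mathbb{R}^{n_b}$, $K=\sum_b(k_bq_b+a_bs_b)q_b^{T}$. Three degrees of freedom are pinned to remove the planar rigid-body modes, $K_{ff}=K_{ff}(k,a)$ is the restriction of $K$ to the remaining $n_{\mathrm{free}}=2N-3$ free ones, $C=K_{ff}^{-1}$. Admissible: all $k_b>0$ and $K_{ff}$ invertible. $w_b=Cq_b$, $z_b=Cs_b$ with $q_b,s_b$ restricted to the free degrees of freedom. Response block: $S$ (driven) and $T$ (read) are sets of free degrees of freedom, $|S|=m_S$, $|T|=m_T$, $P=T\cap S$, $p=|P|$, $R(k,a)=C[T,S]$; $v|_P$ is the restriction of a vector to coordinates in $P$. $\tau,\sigma$ give the positions of elements of $P$ inside $T$ and $S$. $\mathcal{S}_P=\{A\in\mathbb{R}^{m_T\times m_S}:A_{\tau(r)\sigma(c)}=A_{\tau(c)\sigma(r)}\ \forall r,c\in P\}$, $\mathcal{A}_P=\mathcal{S}_P^{\perp}$ (trace inner product), $\Pi_{\mathcal{A}_P}$ the orthogonal projection. $u\wedge v=uv^{T}-vu^{T}$;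 $\Lambda^2\mathbb{R}^p$ is the space of antisymmetric $p\times p$ matrices, to which $\mathcal{A}_P$ is identified by taking the shared $p\times p$ sub-block. *)

(* Defs.v *)
(* MathComp / MathComp-Analysis *)
From HB Require Import structures.
From mathcomp Require Import all_boot all_order all_algebra.
From mathcomp Require Import all_classical all_reals all_analysis.

Set Implicit Arguments.
Unset Strict Implicit.
Unset Printing Implicit Defensive.

Import Order.TTheory GRing.Theory Num.Theory.
Import numFieldNormedType.Exports.

Local Open Scope classical_set_scope.
Local Open Scope ring_scope.

(* The norm `|_| on matrices is the maximum norm, hence this definition. *)
Definition euclid (R : realType) (v : 'rV[R]_2) : R :=
  Num.sqrt (v 0 0 ^+ 2 + v 0 1 ^+ 2).

Definition rot90 (R : realType) (v : 'rV[R]_2) : 'rV[R]_2 :=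
  \row_(c < 2) (if c == 0 then - v 0 1 else v 0 0).

(* A vector of R^(2N) is a field of N planar vectors, i.e. an N x 2 matrix,   *)
(* flattened by mxvec; the degree of freedom (node l, axis c) has index       *)
(* mxvec_index l c : 'I_(N * 2).                                              *)

Definition rigid_mode (R : realType) (N : nat) (x : 'M[R]_(N, 2))
    (c : 'rV[R]_2) (omega : R) : 'M[R]_(N, 2) :=
  \matrix_(l < N) (c + omega *: rot90 (row l x)).

Record network (R : realType) (N nb : nat) := Network {
  pos : 'M[R]_(N, 2);
  src : 'I_nb -> 'I_N;
  tgt : 'I_nb -> 'I_N;
  bond_gt0 : forall b, 0 < euclid (row (tgt b) pos - row (src b) pos);
  pinned : {set 'I_(N * 2)};
  card_pinned : #|pinned| = 3%N;
  pinned_rigid : forall (c : 'rV[R]_2) (omega : R),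
    (forall d, d \in pinned -> mxvec (rigid_mode pos c omega) 0 d = 0) ->
    rigid_mode pos c omega = 0
}.

Definition freedof (R : realType) (N nb : nat) (net : network R N nb) :
  {set 'I_(N * 2)} := ~: pinned net.

Notation nfree net := #|freedof net|.

Lemma card_freedof (R : realType) (N nb : nat) (net : network R N nb) :
  nfree net = (2 * N - 3)%N.
Proof. by rewrite cardsCs finset.setCK card_pinned card_ord mulnC. Qed.

Section Stiffness.
Variables (R : realType) (N nb : nat) (net : network R N nb).
Implicit Types (b : 'I_nb) (k a : 'rV[R]_nb).

Definition bond_vec b : 'rV[R]_2 := row (tgt net b) (pos net) - row (src net b) (pos net).
Definition bond_len b : R := euclid (bond_vec b).
Definition nvec b : 'rV[R]_2 := (bond_len b)^-1 *: bond_vec b.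
Definition tvec b : 'rV[R]_2 := rot90 (nvec b).

(* - v at the first node of b, + v at the second one, 0 elsewhere *)
Definition bond_field b (v : 'rV[R]_2) : 'cV[R]_(N * 2) :=
  (mxvec ((delta_mx (tgt net b) 0 - delta_mx (src net b) 0 : 'cV[R]_N) *m v))^T.

Definition qb b : 'cV[R]_(N * 2) := bond_field b (nvec b).
Definition sb b : 'cV[R]_(N * 2) := bond_field b (tvec b).

Definition Kmx k a : 'M[R]_(N * 2) :=
  \sum_b (k 0 b *: qb b + a 0 b *: sb b) *m (qb b)^T.

Definition Kff k a : 'M[R]_(nfree net) := mxsub enum_val enum_val (Kmx k a).

Definition admissible k a : Prop :=
  (forall b, 0 < k 0 b) /\ Kff k a \in unitmx.

(* Meaningful only where Kff k a is invertible. *)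
Definition Cmx k a : 'M[R]_(nfree net) := invmx (Kff k a).

Definition restrict_free (v : 'cV[R]_(N * 2)) : 'cV[R]_(nfree net) :=
  rowsub enum_val v.

Definition wb k a b : 'cV[R]_(nfree net) := Cmx k a *m restrict_free (qb b).
Definition zb k a b : 'cV[R]_(nfree net) := Cmx k a *m restrict_free (sb b).

End Stiffness.

(* The position in B of the i-th element of A, for A \subset B. *)
Definition sub_pos (I : finType) (A B : {set I}) (sAB : A \subset B)
    (i : 'I_#|A|) : 'I_#|B| :=
  enum_rank_in (fintype.subsetP sAB _ (enum_valP i)) (enum_val i).

Lemma sub_posE (I : finType) (A B : {set I}) (sAB : A \subset B) (i : 'I_#|A|) :
  enum_val (sub_pos sAB i) = enum_val i.
Proof. by rewrite enum_rankK_in // (fintype.subsetP sAB) // enum_valP. Qed.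

Definition wedge (R : realType) (p : nat) (u v : 'cV[R]_p) : 'M[R]_p :=
  u *m v^T - v *m u^T.

Definition trdot (R : realType) (m n : nat) (A B : 'M[R]_(m, n)) : R :=
  \tr (A^T *m B).

Definition orthoc (R : realType) (m n : nat) (E : set 'M[R]_(m, n)) :
  set 'M[R]_(m, n) := [set A | forall B, E B -> trdot A B = 0].

(* The default value 0 is irrelevant when E is a linear subspace. *)
Definition oproj (R : realType) (m n : nat) (E : set 'M[R]_(m, n))
    (A : 'M[R]_(m, n)) : 'M[R]_(m, n) :=
  xget 0 [set B | E B /\ orthoc E (A - B)].

Section Response.
Variables (R : realType) (N nb : nat) (net : network R N nb).
Variables (S T : {set 'I_(nfree net)}).

Definition shared : {set 'I_(nfree net)} := T :&: S.

Definition tau : 'I_#|shared| -> 'I_#|T| := sub_pos (finset.subsetIl T S).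
Definition sigma : 'I_#|shared| -> 'I_#|S| := sub_pos (finset.subsetIr T S).

Definition resp (k a : 'rV[R]_nb) : 'M[R]_(#|T|, #|S|) :=
  mxsub enum_val enum_val (Cmx net k a).

Definition restrict_shared (v : 'cV[R]_(nfree net)) : 'cV[R]_#|shared| :=
  rowsub enum_val v.

Definition symP : set 'M[R]_(#|T|, #|S|) :=
  [set A | forall r c, A (tau r) (sigma c) = A (tau c) (sigma r)].

Definition antiP : set 'M[R]_(#|T|, #|S|) := orthoc symP.

Definition zw_wedge (k a : 'rV[R]_nb) (b : 'I_nb) : 'M[R]_#|shared| :=
  wedge (restrict_shared (zb net k a b)) (restrict_shared (wb net k a b)).

Definition antiresp (k a : 'rV[R]_nb) : 'M[R]_(#|T|, #|S|) :=
  oproj antiP (resp k a).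

(* The pair (k, a) is encoded as the row vector row_mx k a. *)
Definition resp2 (y : 'rV[R]_(nb + nb)) : 'M[R]_(#|T|, #|S|) :=
  resp (lsubmx y) (rsubmx y).

Definition admissible2 : set 'rV[R]_(nb + nb) :=
  [set y | admissible net (lsubmx y) (rsubmx y)].

End Response.

Arguments resp2 {R N nb net} S T y.
Arguments admissible2 {R N nb} net.
Arguments antiP {R N nb net} S T.


(* f, defined on D, is a C^1 map into the linear subspace E near x, and its   *)
(* differential at x is onto E. In finite dimension, continuity of            *)
(* y |-> 'd f y v for every v is continuity of the differential.              *)
Definition submersion_at (R : realType) (n m1 m2 : nat) (D : set 'rV[R]_n)
    (f : 'rV[R]_n -> 'M[R]_(m1, m2)) (E : set 'M[R]_(m1, m2)) (x : 'rV[R]_n) : Prop :=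
  [/\ nbhs x D,
      f @` D `<=` E,
      \forall y \near x, differentiable f y /\
        (forall v, {for y, continuous (fun y' => 'd f y' v)}) &
      range ('d f x) = E].

(* The image under f, defined on D, of every neighbourhood of x contains a    *)
(* neighbourhood of f x in E.                                                 *)
Definition locally_onto (R : realType) (n m1 m2 : nat) (D : set 'rV[R]_n)
    (f : 'rV[R]_n -> 'M[R]_(m1, m2)) (E : set 'M[R]_(m1, m2)) (x : 'rV[R]_n) : Prop :=
  forall U, nbhs x U -> exists2 V, nbhs (f x) V & V `&` E `<=` f @` (U `&` D).

(* Main.v *)
(* Each response is a linear image of the inverse of a stiffness matrix that  *)
(* is affine in the parameters, and A^-1 - B^-1 = - A^-1 (A - B) B^-1 makes   *)
(* such maps strictly differentiable, with differential - C (dK) C. A         *)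
(* strictly differentiable map into the range of a linear projection, whose   *)
(* differential is onto that range, is locally onto it by the contraction     *)
(* principle. At a = 0 the compliance C is symmetric, so the differential is  *)
(* - sum_b a_b z_b w_b^T in the odd couplings, with shared antisymmetric part *)
(* given by the wedges, and it is symmetric on the shared block in the        *)
(* stiffnesses. The rank criterion is then rank-nullity for the map that      *)
(* extracts the antisymmetric part of the shared block.                       *)

Require Import Defs.
From HB Require Import structures.
From mathcomp Require Import all_boot all_order all_algebra.
From mathcomp Require Import all_classical all_reals all_analysis.
From mathcomp Require Import ring.

Set Implicit Arguments.
Unset Strict Implicit.
Unset Printing Implicit Defensive.

Import Order.TTheory GRing.Theory Num.Theory.
Import numFieldNormedType.Exports.

Local Open Scope classical_set_scope.
Local Open Scope ring_scope.

(** Every map in play sends the parameters y to a linear image of the inverse of A0 + Lam y. The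
    resolvent identity makes such a map strictly differentiable ([inv_affine_strictly_diff]), and a
    fixed-point argument turns surjectivity of its differential into exact solvability nearby
    ([strictly_diff_fixpoint], [inv_affine_onto]). What remains is linear algebra on the
    differential - C dK C at a = 0.

    There K is symmetric, hence so is C. A stiffness variation gives a symmetric C dK C, invisible
    to the antisymmetric part of the shared block ([anti_block_even]). A unit odd coupling on bond b
    gives C s_b (C q_b)^T = z_b w_b^T, whose antisymmetric part is the wedge ([anti_block_odd]). So
    spanning wedges make dF onto the antisymmetric blocks, which [orthoc_block_sym] and [oproj_anti]
    describe concretely. Any p(p-1)/2 independent wedges already form a basis ([free_wedges_span]),
    so all other couplings can be frozen at 0.

    For the full response, let rho read off the antisymmetric part of the shared block. The odd
    couplings make rho after dR onto a space of dimension p(p-1)/2, while the stiffness derivatives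
    lie in the kernel of rho. If these have the complementary rank, rank-nullity gives dR full rank
    ([rank_joint]). *)

HB.instance Definition _ (R : realType) (m n : nat) :=
  Complete.copy 'M[R]_(m, n) 'M[R]_(m, n).

(** * Max-norm estimates and continuity of matrix operations *)

Section MatrixNorm.
Variable R : realType.

Lemma mx_norm_leP m n (A : 'M[R]_(m, n)) (e : R) : 0 <= e ->
  reflect (forall i j, `|A i j| <= e) (`|A| <= e).
Proof.
move=> e0; rewrite [`|A|]/Num.Def.normr /= mx_normrE; apply: (iffP idP).
  move=> le i j; apply: le_trans le.
  exact: (le_bigmax 0 (fun ij : 'I_m * 'I_n => `|A ij.1 ij.2|) (i, j)).
by move=> le; apply: bigmax_le => // -[i j] _ /=.
Qed.

Lemma mx_norm_ge m n (A : 'M[R]_(m, n)) i j : `|A i j| <= `|A|.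
Proof. by move: i j; apply/mx_norm_leP. Qed.

Lemma mx_norm_mulmx m n p (A : 'M[R]_(m, n)) (B : 'M[R]_(n, p)) :
  `|A *m B| <= n%:R * `|A| * `|B|.
Proof.
apply/mx_norm_leP => [|i j]; first by rewrite !mulr_ge0.
rewrite mxE (le_trans (ler_norm_sum _ _ _)) //.
rewrite -mulrA mulr_natl -[n in _ *+ n]card_ord -sumr_const.
by apply: ler_sum => k _; rewrite normrM ler_pM // mx_norm_ge.
Qed.

Section Convergence.
Context {T : Type} {F : set_system T} {FF : Filter F}.

Lemma cvg_mxP m n (f : T -> 'M[R]_(m, n)) (A : 'M[R]_(m, n)) :
  f t @[t --> F] --> A <-> forall i j, f t i j @[t --> F] --> A i j.
Proof.
split=> [fA i j|fA].
  exact: (cvg_comp _ _ fA (@coord_continuous _ _ _ i j A)).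
apply/cvgrPdist_le => e e0; near=> t.
apply/mx_norm_leP => [|i j]; first exact: ltW.
rewrite !mxE; move: i j; near: t.
apply: filter_forall => i; apply: filter_forall => j.
by move/cvgrPdist_le : (fA i j); apply.
Unshelve. all: by end_near. Qed.

Lemma cvg_sum_fin (V : normedModType R) (I : finType) (P : pred I)
    (f : I -> T -> V) (l : I -> V) :
  (forall i, P i -> f i t @[t --> F] --> l i) ->
  \sum_(i | P i) f i t @[t --> F] --> \sum_(i | P i) l i.
Proof. by move=> fl; apply: cvg_big => //; apply: add_continuous. Qed.

Lemma cvg_prod_fin (I : finType) (P : pred I) (f : I -> T -> R) (l : I -> R) :
  (forall i, P i -> f i t @[t --> F] --> l i) ->
  \prod_(i | P i) f i t @[t --> F] --> \prod_(i | P i) l i.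
Proof. by move=> fl; apply: cvg_big => //; apply: mul_continuous. Qed.

Lemma cvg_mulmx m n p (f : T -> 'M[R]_(m, n)) (g : T -> 'M[R]_(n, p))
    (A : 'M[R]_(m, n)) (B : 'M[R]_(n, p)) :
  f t @[t --> F] --> A -> g t @[t --> F] --> B ->
  f t *m g t @[t --> F] --> A *m B.
Proof.
move=> /cvg_mxP fA /cvg_mxP gB; apply/cvg_mxP => i j; rewrite mxE.
under eq_cvg do rewrite mxE.
by apply: cvg_sum_fin => k _; apply: cvgM; [exact: fA|exact: gB].
Qed.

Lemma cvg_det n (f : T -> 'M[R]_n) (A : 'M[R]_n) :
  f t @[t --> F] --> A -> \det (f t) @[t --> F] --> \det A.
Proof.
move=> /cvg_mxP fA; apply: cvg_sum_fin => s _; apply: cvgM; first exact: cvg_cst.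
by apply: cvg_prod_fin => i _; exact: fA.
Qed.

Lemma near_unitmx n (f : T -> 'M[R]_n) (A : 'M[R]_n) :
  A \in unitmx -> f t @[t --> F] --> A -> \forall t \near F, f t \in unitmx.
Proof.
rewrite unitmxE unitfE => A0 /cvg_det.
move=> fdet; near=> t; rewrite unitmxE unitfE.
by near: t; exact: cvgr_neq0 fdet A0.
Unshelve. all: by end_near. Qed.

Lemma cvg_invmx n (f : T -> 'M[R]_n) (A : 'M[R]_n) :
  A \in unitmx -> f t @[t --> F] --> A -> invmx (f t) @[t --> F] --> invmx A.
Proof.
move=> uA fA; have detA : \det A != 0 by rewrite -unitfE -unitmxE.
rewrite /invmx uA.
(* [invmx] is defined by cases; close to the invertible A only its adjugate branch occurs, and that
   one is polynomial over a nonvanishing determinant. *)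
apply: (@cvg_trans _ ((fun t => (\det (f t))^-1 *: \adj (f t)) @ F)).
  apply: near_eq_cvg; near=> t.
  by have -> : f t \in unitmx by near: t; exact: near_unitmx fA.
have dV : (\det (f t))^-1 @[t --> F] --> (\det A)^-1.
  by apply: (@cvgV R T F FF (fun t => \det (f t))) => //; exact: cvg_det.
apply: cvgZ => //.
apply/cvg_mxP => i j; rewrite mxE.
under eq_cvg do rewrite mxE.
apply: cvgM; first exact: cvg_cst.
apply: cvg_det; apply/cvg_mxP => k l; rewrite !mxE.
by under eq_cvg do rewrite !mxE; have /cvg_mxP fA' := fA; exact: fA'.
Unshelve. all: by end_near. Qed.

End Convergence.

Lemma linear_mx_continuous m n (W : normedModType R)
  (f : {linear 'M[R]_(m, n) -> W}) : continuous f.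
Proof.
move=> A.
have fE B : f B = \sum_i \sum_j B i j *: f (delta_mx i j).
  rewrite {1}[B]matrix_sum_delta raddf_sum; apply: eq_bigr => i _.
  rewrite raddf_sum; apply: eq_bigr => j _; exact: linearZ.
rewrite /continuous_at fE; under eq_cvg do rewrite fE.
apply: (@cvg_sum_fin _ (nbhs A)) => i _; apply: (@cvg_sum_fin _ (nbhs A)) => j _.
by apply: cvgZ; [exact: coord_continuous|exact: cvg_cst].
Qed.

End MatrixNorm.

(** * Strict differentiability *)

Section StrictDifferentiability.
Variables (R : realType) (V W : normedModType R).

(** Both points vary, so f - L is Lipschitz near x with arbitrarily small constant; this is the form
    that a contraction argument needs. *)
Definition strictly_diff (f L : V -> W) (x : V) := forall e, 0 < e ->
  exists2 d, 0 < d & forall y z, `|y - x| < d -> `|z - x| < d ->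
    `|f y - f z - L (y - z)| <= e * `|y - z|.

Lemma strictly_diff_diff f (L : {linear V -> W}) x :
  continuous L -> strictly_diff f L x ->
  differentiable f x /\ 'd f x = L :> (V -> W).
Proof.
move=> cL sL.
have fx : f \o shift x = cst (f x) + L +o_ 0 id.
  apply/eqaddoP => e e0; have [d d0 dP] := sL _ e0.
  apply/nbhs_normP; exists d => //= h /=; rewrite sub0r normrN => hd.
  have := dP (h + x) x; rewrite addrK subrr normr0 => /(_ hd d0).
  by rewrite /= !fctE /= opprD addrA.
by split; [apply/diff_locallyP|]; rewrite (diff_unique cL fx).
Qed.

End StrictDifferentiability.

(** * Local solvability by the contraction principle *)

Section StrictSurjectivity.
Variables (R : realType) (V : normedModType R) (W : completeNormedModType R).

(* Strict differentiability makes u |-> pi u - (f (x + G u) - w) a            *)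
(* contraction of a small ball. Having [pi u] in it, rather than [u], allows  *)
(* G to be a right inverse on the range of pi only.                           *)
Lemma strictly_diff_fixpoint (f L : V -> W) (G : {linear W -> V})
    (pi : W -> W) x :
  continuous G -> strictly_diff f L x -> (forall w, L (G w) = pi w) ->
  (forall u v, pi (u - v) = pi u - pi v) ->
  forall e, 0 < e -> exists2 d, 0 < d & forall w, `|w - f x| < d ->
    exists2 u, `|G u| < e & pi u - (f (x + G u) - w) = u.
Proof.
move=> cG sL LG piB e e0.
have [k k0 kP] := linear_lipschitz cG.
(* This tolerance absorbs the Lipschitz constant k of G and leaves the contraction ratio 1/2. *)
have [d d0 dP] := sL (2 * k)^-1 (ltac:(by rewrite invr_gt0 mulr_gt0)).
set m := Num.min d e.
have m0 : 0 < m by rewrite lt_min d0.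
pose r := m / (2 * k).
have r0 : 0 < r by rewrite divr_gt0 // mulr_gt0.
have Gr u : `|u| <= r -> `|G u| < m.
  move=> ur; apply: le_lt_trans (kP u) _.
  apply: (@le_lt_trans _ _ (k * r)); first by rewrite ler_pM2l.
  have -> : k * r = m / 2 by rewrite /r; field; rewrite gt_eqF.
  by rewrite ltr_pdivrMr // ltr_pMr // ltr1n.
(* As H 0 = w - f x, this makes H 0 at most r / 2, and the ratio 1/2 then keeps the ball of radius r
   stable under H. *)
exists (r / 2) => [|w wf]; first by rewrite divr_gt0.
pose H u := pi u - (f (x + G u) - w).
have Hlip u v : `|u| <= r -> `|v| <= r -> `|H u - H v| <= 2^-1 * `|u - v|.
  move=> ur vr.
  have GB : x + G u - (x + G v) = G (u - v).
    by rewrite linearB opprD addrACA subrr add0r.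
  (* Since L (G u) = pi u, the terms in pi are the linear part of the remainder. *)
  have -> : H u - H v =
      - (f (x + G u) - f (x + G v) - L ((x + G u) - (x + G v))).
    rewrite GB LG piB /H !opprB !addrA [LHS](ACl (1*6*4*3*(2*5))) /=.
    by rewrite subrr addr0.
  rewrite normrN (le_trans (dP _ _ _ _)) //.
  - by rewrite addrC addKr (lt_le_trans (Gr _ ur)) // ge_min lexx.
  - by rewrite addrC addKr (lt_le_trans (Gr _ vr)) // ge_min lexx.
  - rewrite GB invfM -mulrA ler_pM2l ?invr_gt0// ler_pdivrMl //; exact: kP.
have H0 : `|H 0| <= r / 2.
  rewrite /H; have -> : pi 0 = 0 by rewrite -[X in pi X](subrr 0) piB subrr.
  by rewrite linear0 addr0 sub0r opprB ltW.
pose B := [set u : W | `|u| <= r].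
have HB u : B u -> B (H u).
  rewrite /B /= => ur; rewrite -[H u](subrK (H 0)) (splitr r).
  rewrite (le_trans (ler_normD _ _)) // lerD //.
  have r00 : `|0 : W| <= r by rewrite normr0 ltW.
  by apply: le_trans (Hlip _ _ ur r00) _; rewrite subr0 mulrC ler_pM2r.
pose HF : {fun B >-> B} := HB.pack H (isFun.Build _ _ B B H HB).
have ctr : is_contraction HF.
  exists (2^-1)%:nng; split => /=; first by rewrite invf_lt1 // ltr1n.
  by move=> [u v] [/= uB vB]; exact: Hlip.
have cB : closed B.
  rewrite /B; have -> : [set u : W | `|u| <= r] = closed_ball 0 r.
    by rewrite closed_ballE //; apply/seteqP; split => u; rewrite /closed_ball_ /= sub0r normrN.
  exact: closed_ball_closed.
have [|u uB uH] := banach_fixed_point ctr cB.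
  by exists 0; rewrite /B /= normr0 ltW.
by exists u; [rewrite (lt_le_trans (Gr _ uB)) // ge_min lexx orbT|].
Qed.

End StrictSurjectivity.

(** * Linear images of the inverse of an affine matrix family *)

Section InverseOfAffine.
Variables (R : realType) (n q m1 m2 : nat) (A0 : 'M[R]_n).
Variables (Lam : {linear 'rV[R]_q -> 'M[R]_n}).
Variables (Z : {linear 'M[R]_n -> 'M[R]_(m1, m2)}).
Implicit Types x y z v : 'rV[R]_q.

(** One shape for all uses: F takes A0 = [Keven net k0], Lam = [Kodd net] and Z the antisymmetrised
    block; the joint response takes A0 = 0 and Lam = [Kjoint net]; Jacobians put [mxvec] into Z. *)
Definition inv_affine y : 'M[R]_(m1, m2) := Z (invmx (A0 + Lam y)).

Definition dinv_affine y v : 'M[R]_(m1, m2) :=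
  - Z (invmx (A0 + Lam y) *m Lam v *m invmx (A0 + Lam y)).

Lemma dinv_affine_linear y : linear (dinv_affine y).
Proof.
move=> a u v; rewrite /dinv_affine linearP mulmxDr mulmxDl.
by rewrite -scalemxAr -scalemxAl linearP opprD scalerN.
Qed.

Lemma affine_continuous : continuous (fun y => A0 + Lam y).
Proof. by move=> y; apply: (@cvgD _ _ _ (nbhs y)); [exact: cvg_cst|exact: linear_mx_continuous]. Qed.

Lemma near_affine_unit x : A0 + Lam x \in unitmx -> \forall y \near x, A0 + Lam y \in unitmx.
Proof. by move=> uA; exact: near_unitmx uA (@affine_continuous x). Qed.

Lemma inv_affine_strictly_diff x : A0 + Lam x \in unitmx ->
  strictly_diff inv_affine (dinv_affine x) x.
Proof.
move=> uA e e0.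
have [kL kL0 kLP] := linear_lipschitz (@linear_mx_continuous _ _ _ _ Lam).
have [kZ kZ0 kZP] := linear_lipschitz (@linear_mx_continuous _ _ _ _ Z).
set C0 := invmx (A0 + Lam x).
(* The remainder will be at most B * h * [|y - z|]. Each matrix product costs a factor n in the max
   norm, and the two error terms contribute [|C0| + 1] and [|C0|]. *)
pose B := kZ * n%:R * n%:R * (2 * `|C0| + 1) * kL.
have B0 : 0 <= B by rewrite !mulr_ge0 ?addr_ge0 ?mulr_ge0 // ltW.
pose h := Num.min 1 (e / (B + 1)).
have h0 : 0 < h by rewrite lt_min ltr01 divr_gt0 // ltr_wpDl.
have Bh : B * h <= e.
  apply: (@le_trans _ _ (B * (e / (B + 1)))).
    by rewrite ler_wpM2l // ge_min lexx orbT.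
  by rewrite mulrCA ger_pMr // ler_pdivrMr ?ltr_wpDl // mul1r lerDl.
have : \forall y \near x, A0 + Lam y \in unitmx /\ `|C0 - invmx (A0 + Lam y)| <= h.
  near=> y; split; near: y; first exact: near_affine_unit.
  have /cvgrPdist_le : invmx (A0 + Lam y) @[y --> x] --> C0.
    exact: cvg_invmx uA (@affine_continuous x).
  exact.
move=> /nbhs_normP [d /= d0 dP]; exists d => // y z.
rewrite distrC => /dP [uy yh]; rewrite distrC => /dP [uz zh].
have Cz1 : `|invmx (A0 + Lam z)| <= `|C0| + 1.
  rewrite -[invmx (A0 + Lam z)](subrK C0) addrC (le_trans (ler_normD _ _)) // lerD //.
  by rewrite distrC (le_trans zh) // ge_min lexx.
have resolvent : invmx (A0 + Lam y) - invmx (A0 + Lam z) =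
    - (invmx (A0 + Lam y) *m Lam (y - z) *m invmx (A0 + Lam z)).
  have -> : Lam (y - z) = A0 + Lam y - (A0 + Lam z) by rewrite linearB opprD addrACA subrr add0r.
  rewrite mulmxBr mulVmx // mulmxBl mul1mx -mulmxA mulmxV // mulmx1.
  by rewrite opprB.
set M := Lam (y - z).
(* Replacing the outer inverses by C0 one at a time leaves two terms, each with a factor of norm at
   most h. *)
have -> : inv_affine y - inv_affine z - dinv_affine x (y - z) =
    - Z ((invmx (A0 + Lam y) - C0) *m M *m invmx (A0 + Lam z) + C0 *m M *m (invmx (A0 + Lam z) - C0)).
  rewrite /inv_affine -linearB resolvent /dinv_affine opprK -linearD -[RHS]linearN.
  congr (Z _); rewrite -/M -/C0 !mulmxBl mulmxBr.
  by rewrite addrA subrK opprB addrC.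
rewrite normrN (le_trans (kZP _)) //.
have M0 : `|M| <= kL * `|y - z| by exact: kLP.
apply: (@le_trans _ _ (kZ * (n%:R * (n%:R * h * `|M|) * (`|C0| + 1) +
   n%:R * (n%:R * `|C0| * `|M|) * h))).
  rewrite ler_pM2l // (le_trans (ler_normD _ _)) // lerD //.
    rewrite (le_trans (mx_norm_mulmx _ _)) // ler_pM ?mulr_ge0 //.
    rewrite ler_wpM2l // (le_trans (mx_norm_mulmx _ _)) //.
    by rewrite ler_wpM2r // ler_wpM2l // distrC.
  rewrite (le_trans (mx_norm_mulmx _ _)) // ler_pM ?mulr_ge0 // 1?distrC //.
  by rewrite ler_wpM2l // mx_norm_mulmx.
rewrite (_ : kZ * _ = kZ * n%:R * n%:R * (2 * `|C0| + 1) * h * `|M|); last by ring.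
apply: (@le_trans _ _ (B * h * `|y - z|)); last by rewrite ler_wpM2r.
rewrite (_ : B * h * _ = kZ * n%:R * n%:R * (2 * `|C0| + 1) * h * (kL * `|y - z|)).
  by rewrite ler_wpM2l // !mulr_ge0 ?addr_ge0 ?mulr_ge0 // ltW.
by rewrite /B; ring.
Unshelve. all: by end_near. Qed.

Lemma inv_affine_diff x : A0 + Lam x \in unitmx ->
  differentiable inv_affine x /\ forall v, 'd inv_affine x v = dinv_affine x v.
Proof.
move=> uA.
pose L : {linear 'rV[R]_q -> 'M[R]_(m1, m2)} :=
  HB.pack (dinv_affine x)
    (GRing.isLinear.Build _ _ _ _ (dinv_affine x) (dinv_affine_linear x)).
have [df dE] := @strictly_diff_diff _ _ _ inv_affine L x
  (@linear_mx_continuous _ _ _ _ L) (inv_affine_strictly_diff uA).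
by split=> // v; rewrite dE.
Qed.

Lemma inv_affine_C1 x : A0 + Lam x \in unitmx ->
  \forall y \near x, differentiable inv_affine y /\
    (forall v, {for y, continuous (fun y' => 'd inv_affine y' v)}).
Proof.
move=> uA; near=> y.
have uy : A0 + Lam y \in unitmx by near: y; exact: near_affine_unit.
split=> [|v]; first exact: (inv_affine_diff uy).1.
suff : 'd inv_affine z v @[z --> y] --> dinv_affine y v.
  by rewrite -((inv_affine_diff uy).2 v).
apply: (@cvg_trans _ ((fun z => dinv_affine z v) @ y)).
  apply: (@near_eq_cvg _ _ (nbhs y)).
  apply: filterS (near_affine_unit uy) => z uz.
  exact/esym/(inv_affine_diff uz).2.
have Cy : invmx (A0 + Lam z) @[z --> y] --> invmx (A0 + Lam y).
  exact: cvg_invmx uy (@affine_continuous y).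
have CLC : invmx (A0 + Lam z) *m Lam v *m invmx (A0 + Lam z) @[z --> y] -->
    invmx (A0 + Lam y) *m Lam v *m invmx (A0 + Lam y).
  exact: cvg_mulmx (cvg_mulmx Cy (cvg_cst _)) Cy.
apply: (@cvgN _ _ _ (nbhs y)).
exact: (cvg_comp _ _ CLC (@linear_mx_continuous _ _ _ _ Z _)).
Unshelve. all: by end_near. Qed.

Variable pi : {linear 'M[R]_(m1, m2) -> 'M[R]_(m1, m2)}.

(** The projection pi cuts out the subspace in which the map takes its values; the differential
    needs a right inverse only there. *)
Lemma inv_affine_onto x : A0 + Lam x \in unitmx -> (forall M, pi (Z M) = Z M) ->
  (forall w, pi w = w -> exists v, dinv_affine x v = w) ->
  (forall w, pi (pi w) = pi w) ->
  forall e, 0 < e -> exists2 d, 0 < d & forall w, pi w = w ->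
    `|w - inv_affine x| < d -> exists2 y, `|y - x| < e & inv_affine y = w.
Proof.
move=> uA piZ Lonto piK e e0.
pose L : {linear 'rV[R]_q -> 'M[R]_(m1, m2)} :=
  HB.pack (dinv_affine x)
    (GRing.isLinear.Build _ _ _ _ (dinv_affine x) (dinv_affine_linear x)).
(* The pseudo-inverse of the vectorised differential, applied after pi, is a linear choice of
   preimages of pi w. *)
pose Lmx : 'M[R]_(q, m1 * m2) := lin1_mx (mxvec \o L).
pose G : {linear 'M[R]_(m1, m2) -> 'rV[R]_q} :=
  mulmxr (pinvmx Lmx) \o (mxvec \o pi).
have LG w : dinv_affine x (G w) = pi w.
  have [v vw] := Lonto (pi w) (piK w).
  rewrite -[RHS]mxvecK -[LHS]mxvecK; congr vec_mx.
  rewrite -[LHS](mul_rV_lin1 (mxvec \o L)) /G /= mulmxKpV //.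
  by apply/submxP; exists v; rewrite mul_rV_lin1 /= -vw.
have [d d0 dP] := strictly_diff_fixpoint (@linear_mx_continuous _ _ _ _ G)
   (inv_affine_strictly_diff uA) LG (linearB pi) e0.
exists d => // w piw /dP[u Gu uE]; exists (x + G u).
  by rewrite addrC addKr.
(* Applying pi to the fixed-point equation leaves its left side unchanged, as f and w are fixed by
   pi. Hence u is fixed too and the equation collapses to f = w. *)
have piu : pi u = u.
  rewrite -[in RHS]uE -[in LHS]uE linearB piK; congr (_ - _).
  by rewrite linearB piw piZ.
by move: uE; rewrite piu -[RHS]subr0 => /addrI/oppr_inj/eqP; rewrite subr_eq0 => /eqP.
Qed.

End InverseOfAffine.

(** * Submersions onto the range of a projection *)

Section InverseOfAffineSubmersion.
Variables (R : realType) (n q m1 m2 : nat) (A0 : 'M[R]_n).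
Variables (Lam : {linear 'rV[R]_q -> 'M[R]_n}).
Variables (Z : {linear 'M[R]_n -> 'M[R]_(m1, m2)}).
Variable pi : {linear 'M[R]_(m1, m2) -> 'M[R]_(m1, m2)}.

Lemma inv_affine_submersion (D : set 'rV[R]_q) x :
  A0 + Lam x \in unitmx -> nbhs x D ->
  (forall M, pi (Z M) = Z M) ->
  (forall w, pi w = w -> exists v, dinv_affine A0 Lam Z x v = w) ->
  (forall w, pi (pi w) = pi w) ->
  submersion_at D (inv_affine A0 Lam Z) [set w | pi w = w] x /\
  locally_onto D (inv_affine A0 Lam Z) [set w | pi w = w] x.
Proof.
move=> uA xD piZ Lonto piK; split.
  split=> //; first by move=> _ [y _ <-] /=; exact: piZ.
    exact: inv_affine_C1.
  have dE := (inv_affine_diff Z uA).2.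
  apply/seteqP; split=> [_ [v _ <-]|w /Lonto[v <-]] /=.
    by rewrite dE /dinv_affine linearN piZ.
  by exists v => //; exact: dE.
move=> U xU.
have /nbhs_normP[e /= e0 eP] : nbhs x (U `&` D) by exact: filterI.
have [d d0 dP] := inv_affine_onto uA piZ Lonto piK e0.
exists (ball (inv_affine A0 Lam Z x) d); first exact: nbhsx_ballx.
rewrite -ball_normE.
move=> w [/= wd /dP].
by rewrite distrC => /(_ wd)[y yx yw]; exists y => //; apply: eP => /=; rewrite distrC.
Qed.

End InverseOfAffineSubmersion.

(** * Coordinates and dimension of the antisymmetric matrices *)

Section AntisymmetricMatrices.
Variable p : nat.

Definition upper_pairs : {set 'I_p * 'I_p} :=
  [set x : 'I_p * 'I_p | (x.1 < x.2)%N].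

Lemma card_upper_pairs : #|upper_pairs| = ((p * (p - 1)) %/ 2)%N.
Proof.
(* Sorted by their larger index j, the pairs number j for each j < p, and these numbers add up to
   the binomial coefficient of p over 2. *)
rewrite subn1 divn2 -bin2 -bin2_sum big_mkord -sum1_card.
rewrite (eq_bigl (fun x : 'I_p * 'I_p => true && (x.1 < x.2)%N)); last first.
  by move=> x; rewrite inE.
rewrite -(pair_big_dep xpredT (fun i j : 'I_p => (i < j)%N) (fun _ _ => 1%N)) /=.
rewrite (exchange_big_dep xpredT) //=; apply: eq_bigr => j _.
rewrite (big_ord_narrow (ltnW (ltn_ord j))).
by rewrite sum1_card card_ord.
Qed.

Variable R : realType.

(** Coordinates on the antisymmetric matrices, with inverse [of_upper]; on general matrices the map
    only forgets entries. *)
Definition upper (M : 'M[R]_p) : 'rV[R]_#|upper_pairs| :=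
  \row_j M (enum_val j).1 (enum_val j).2.

Definition elem_anti (j : 'I_#|upper_pairs|) : 'M[R]_p :=
  delta_mx (enum_val j).1 (enum_val j).2 - delta_mx (enum_val j).2 (enum_val j).1.

Definition of_upper (t : 'rV[R]_#|upper_pairs|) : 'M[R]_p :=
  \sum_j t 0 j *: elem_anti j.

Lemma upper_linear : linear upper.
Proof. by move=> a M N; apply/rowP => j; rewrite !mxE. Qed.

HB.instance Definition _ := GRing.isLinear.Build _ _ _ _ upper upper_linear.

Lemma of_upper_anti t : (of_upper t)^T = - of_upper t.
Proof.
rewrite /of_upper linear_sum -sumrN; apply: eq_bigr => j _.
by rewrite linearZ /= linearB /= !trmx_delta -scalerN opprB.
Qed.

Lemma upper_ofK t : upper (of_upper t) = t.
Proof.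
apply/rowP => i; rewrite mxE summxE (bigD1 i) //= big1 ?addr0.
  have := enum_valP i; rewrite inE => lti.
  have ne : ((enum_val i).2 == (enum_val i).1) = false.
    by apply: contraTF lti => /eqP ->; rewrite ltnn.
  by rewrite !mxE !eqxx ne andbF subr0 mulr1.
move=> j ji; rewrite !mxE.
have := enum_valP i; have := enum_valP j; rewrite !inE => ltj lti.
have -> : ((enum_val i).1 == (enum_val j).1) &&
    ((enum_val i).2 == (enum_val j).2) = false.
  apply: contraNF ji => /andP[/eqP e1 /eqP e2].
  by rewrite eq_sym -(inj_eq enum_val_inj); apply/eqP/injective_projections.
have -> : ((enum_val i).1 == (enum_val j).2) &&
    ((enum_val i).2 == (enum_val j).1) = false.
  apply: contraTF lti => /andP[/eqP -> /eqP ->].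
  by rewrite -leqNgt ltnW.
by rewrite subr0 mulr0.
Qed.

Lemma upper_inj (M N : 'M[R]_p) :
  M^T = - M -> N^T = - N -> upper M = upper N -> M = N.
Proof.
move=> aM aN MN.
have lt_eq (i j : 'I_p) : (i < j)%N -> M i j = N i j.
  move=> ij; have Jij : (i, j) \in upper_pairs by rewrite inE.
  have := congr1 (fun t : 'rV__ => t 0 (enum_rank_in Jij (i, j))) MN.
  by rewrite !mxE enum_rankK_in.
have anti (P : 'M[R]_p) i j : P^T = - P -> P i j = - P j i.
  by move=> /matrixP/(_ j i); rewrite !mxE.
apply/matrixP => i j; case: (ltngtP i j) => [/lt_eq //|ji|ij].
  by rewrite (anti M) // (anti N) // lt_eq.
have -> : i = j by exact/val_inj.
have diag (P : 'M[R]_p) : P^T = - P -> P j j = 0.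
  by move=> /(anti _ j j)/eqP; rewrite -addr_eq0 -mulr2n mulrn_eq0 /= => /eqP.
by rewrite !diag.
Qed.

Lemma anti_upperK (M : 'M[R]_p) : M^T = - M -> of_upper (upper M) = M.
Proof.
by move=> aM; apply: upper_inj => //; [exact: of_upper_anti|exact: upper_ofK].
Qed.

(** The matrices [elem_anti] generate, so their number bounds the dimension. This is what makes a
    free family of that size a basis. *)
Lemma dim_anti_le (V : {vspace 'M[R]_p}) :
  (forall M, M \in V -> M^T = - M) -> (\dim V <= #|upper_pairs|)%N.
Proof.
move=> aV; pose X := [seq elem_anti j | j <- enum 'I_#|upper_pairs|].
have sVX : (V <= <<X>>)%VS.
  apply/subvP => M /aV/anti_upperK <-.
  apply: rpred_sum => j _; apply: rpredZ; apply: memv_span.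
  by apply: map_f; rewrite mem_enum.
by rewrite (leq_trans (dimvS sVX)) // (leq_trans (dim_span _)) // size_map size_enum_ord.
Qed.

End AntisymmetricMatrices.

(** The coefficients are indexed by the whole of I, so that they can serve as a vector of couplings;
    their support in s becomes the support of that vector. *)
Lemma span_map_sum (K : fieldType) (V : vectType K) (I : finType) (f : I -> V)
    (s : seq I) v : v \in <<[seq f i | i <- s]>>%VS ->
  exists2 c : I -> K, (forall i, i \notin s -> c i = 0) & v = \sum_i c i *: f i.
Proof.
elim: s v => [|a s IHs] v /=.
  rewrite span_nil memv0 => /eqP ->; exists (fun=> 0) => //.
  by rewrite big1 // => i _; rewrite scale0r.
rewrite span_cons => /memv_addP[_ /vlineP[k ->] [u /IHs[c c0 ->] ->]].
(* The coefficient is added to c a because a may occur again in s. *)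
exists (fun i => c i + k * (i == a)%:R) => [i|].
  by rewrite inE negb_or => /andP[/negbTE -> /c0 ->]; rewrite mulr0 addr0.
under [RHS]eq_bigr do rewrite scalerDl.
rewrite big_split /= addrC; congr (_ + _).
rewrite (bigD1 a) //= eqxx mulr1 big1 ?addr0 // => i /negbTE ->.
by rewrite mulr0 scale0r.
Qed.

(** * The trace inner product and orthogonal projections *)

Section TraceForm.
Variables (R : realType) (m n : nat).
Implicit Types A B : 'M[R]_(m, n).

Lemma trdotE A B : trdot A B = \sum_i \sum_j A i j * B i j.
Proof.
rewrite /trdot /mxtrace exchange_big /=; apply: eq_bigr => j _.
by rewrite mxE; apply: eq_bigr => i _; rewrite mxE.
Qed.

Lemma trdotC A B : trdot A B = trdot B A.
Proof. by rewrite /trdot -mxtrace_tr trmx_mul trmxK. Qed.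

Lemma trdotDr A B B' : trdot A (B + B') = trdot A B + trdot A B'.
Proof. by rewrite /trdot mulmxDr linearD. Qed.

Lemma trdotNr A B : trdot A (- B) = - trdot A B.
Proof. by rewrite /trdot mulmxN linearN. Qed.

Lemma trdotZr A k B : trdot A (k *: B) = k * trdot A B.
Proof. by rewrite /trdot -scalemxAr linearZ. Qed.

Lemma trdot_eq0 A : trdot A A = 0 -> A = 0.
Proof.
rewrite trdotE => /eqP; rewrite psumr_eq0 => [/allP A0|i _]; last first.
  by apply: sumr_ge0 => j _; rewrite -expr2 sqr_ge0.
apply/matrixP => i j; rewrite mxE.
have := A0 i; rewrite mem_index_enum => /(_ isT) /=.
rewrite psumr_eq0 => [/allP/(_ j)|k _]; last by rewrite -expr2 sqr_ge0.
by rewrite mem_index_enum => /(_ isT) /=; rewrite mulf_eq0 orbb => /eqP.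
Qed.

(** Two candidates B and C differ by an element of E orthogonal to E, hence to itself, so they agree
    and [xget] must return B. *)
Lemma oprojE (E : set 'M[R]_(m, n)) A B :
  (forall X Y, E X -> E Y -> E (X - Y)) ->
  E B -> orthoc E (A - B) -> oproj E A = B.
Proof.
move=> EB_ EB oB; apply: xget_unique => // C [EC oC].
apply/eqP; rewrite -subr_eq0; apply/eqP/trdot_eq0.
have := oB _ (EB_ _ _ EC EB); have := oC _ (EB_ _ _ EC EB).
rewrite ![trdot _ (C - B)]trdotC => c0 b0.
have CB : C - B = (A - B) - (A - C) by rewrite opprB [RHS]addrC subrKA.
by rewrite [X in trdot _ X]CB trdotDr trdotNr b0 c0 subr0.
Qed.

End TraceForm.

(** * Projection onto the antisymmetric part of a sub-block *)

Section BlockProjection.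
Variables (R : realType) (p m n : nat) (t : 'I_p -> 'I_m) (s : 'I_p -> 'I_n).
Hypotheses (t_inj : injective t) (s_inj : injective s).
Implicit Types (A B : 'M[R]_(m, n)) (M : 'M[R]_p).

Definition block_embed M : 'M[R]_(m, n) :=
  \sum_r \sum_c M r c *: delta_mx (t r) (s c).

Definition anti_block A : 'M[R]_p := mxsub t s A - (mxsub t s A)^T.

(** The factor 1/2 compensates for [anti_block], which is twice the antisymmetric part, and makes
    the map idempotent. *)
Definition anti_proj A : 'M[R]_(m, n) := 2^-1 *: block_embed (anti_block A).

Lemma block_embedK M : mxsub t s (block_embed M) = M.
Proof.
apply/matrixP => i j; rewrite mxE /block_embed summxE (bigD1 i) //= [X in _ + X]big1 ?addr0.
  rewrite summxE (bigD1 j) //= big1 ?addr0 => [|c cj].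
    by rewrite !mxE !eqxx mulr1.
  by rewrite !mxE (inj_eq s_inj) [j == c]eq_sym (negbTE cj) andbF mulr0.
move=> r ri; rewrite summxE big1 // => c _.
by rewrite !mxE (inj_eq t_inj) eq_sym (negbTE ri) mulr0.
Qed.

Lemma block_embed_linear : linear block_embed.
Proof.
move=> a M M'; rewrite scaler_sumr -big_split; apply: eq_bigr => r _ /=.
rewrite scaler_sumr -big_split; apply: eq_bigr => c _ /=.
by rewrite !mxE scalerDl scalerA.
Qed.

HB.instance Definition _ :=
  GRing.isLinear.Build _ _ _ _ block_embed block_embed_linear.

Lemma anti_block_linear : linear anti_block.
Proof.
move=> a A B; apply/matrixP => i j; rewrite !mxE; ring.
Qed.

HB.instance Definition _ :=
  GRing.isLinear.Build _ _ _ _ anti_block anti_block_linear.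

Lemma anti_proj_linear : linear anti_proj.
Proof.
move=> a A B; rewrite /anti_proj.
by rewrite (linearP anti_block) (linearP block_embed) scalerDr !scalerA mulrC.
Qed.

HB.instance Definition _ :=
  GRing.isLinear.Build _ _ _ _ anti_proj anti_proj_linear.

Lemma anti_block_tr A : (anti_block A)^T = - anti_block A.
Proof. by rewrite linearB /= trmxK opprB. Qed.

Lemma anti_block_embed M : M^T = - M -> anti_block (2^-1 *: block_embed M) = M.
Proof.
move=> aM; rewrite linearZ /= /anti_block block_embedK aM opprK -mulr2n.
by rewrite -[M *+ 2]scaler_nat scalerA mulVf ?scale1r // pnatr_eq0.
Qed.

Lemma anti_block_proj A : anti_block (anti_proj A) = anti_block A.
Proof. exact/anti_block_embed/anti_block_tr. Qed.

Lemma anti_projK A : anti_proj (anti_proj A) = anti_proj A.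
Proof. by rewrite {1}/anti_proj anti_block_proj. Qed.

(** Embedding and extracting a block are adjoint; orthogonality thereby reduces to square matrices,
    where symmetric and antisymmetric ones are orthogonal. *)
Lemma trdot_embed A M : trdot A (block_embed M) = trdot (mxsub t s A) M.
Proof.
rewrite {1}/trdot mulmx_sumr linear_sum trdotE /=; apply: eq_bigr => r _.
rewrite mulmx_sumr linear_sum /=; apply: eq_bigr => c _.
rewrite -/(trdot _ _) trdotZr mulrC; congr (_ * _); rewrite mxE trdotE.
rewrite (bigD1 (t r)) //= [X in _ + X]big1 ?addr0 => [|i ir]; last first.
  by apply: big1 => j _; rewrite mxE (negbTE ir) mulr0.
rewrite (bigD1 (s c)) //= big1 ?addr0 => [|j jc]; last first.
  by rewrite mxE (negbTE jc) andbF mulr0.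
by rewrite mxE !eqxx mulr1.
Qed.

Lemma trdot_sym_anti (X Y : 'M[R]_p) : X^T = X -> Y^T = - Y -> trdot X Y = 0.
Proof.
move=> sX aY.
have E : trdot X Y = - trdot X Y.
  by rewrite {1}/trdot -mxtrace_tr trmx_mul trmxK aY mulNmx linearN
             [in RHS]/trdot sX /= mxtrace_mulC.
by move/eqP: E; rewrite -addr_eq0 -mulr2n mulrn_eq0 /= => /eqP.
Qed.

Definition block_sym : set 'M[R]_(m, n) := [set A | anti_block A = 0].

Lemma trdot_sym_proj A B : block_sym A -> trdot A (anti_proj B) = 0.
Proof.
move=> /eqP; rewrite subr_eq0 => /eqP sA.
rewrite trdotZr trdot_embed trdot_sym_anti ?mulr0 //.
exact: anti_block_tr.
Qed.

Lemma oproj_anti A : oproj (orthoc block_sym) A = anti_proj A.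
Proof.
apply: oprojE => [X Y oX oY B sB|B sB|B oB].
- by rewrite trdotC trdotDr trdotNr ![trdot B _]trdotC oX // oY // subrr.
- by rewrite trdotC trdot_sym_proj.
- rewrite trdotC oB // /block_sym /=.
  by rewrite linearB /= anti_block_proj subrr.
Qed.

(** A member of the complement is its own orthogonal projection, which [oproj_anti] computes as
    [anti_proj]. *)
Lemma orthoc_block_sym : orthoc block_sym = [set A | anti_proj A = A].
Proof.
apply/seteqP; split=> A /=.
  move=> oA; rewrite -oproj_anti; apply: oprojE => // [X Y oX oY B sB|B oB].
    by rewrite trdotC trdotDr trdotNr ![trdot B _]trdotC oX // oY // subrr.
  by rewrite subrr trdotC -(scale0r A) trdotZr mul0r.
by move=> <- B sB; rewrite trdotC trdot_sym_proj.
Qed.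

End BlockProjection.

Lemma sub_pos_inj (I : finType) (A B : {set I}) (sAB : A \subset B) :
  injective (sub_pos sAB).
Proof.
by move=> i j /(congr1 enum_val); rewrite !sub_posE => /enum_val_inj.
Qed.

(** * Even and odd parts of the stiffness matrix *)

Section NetworkStiffness.
Variables (R : realType) (N nb : nat) (net : network R N nb).
Local Notation M := 'M[R]_(nfree net).
Implicit Types (k a : 'rV[R]_nb) (b : 'I_nb).

Let qf b := restrict_free net (qb net b).
Let sf b := restrict_free net (sb net b).

Definition Keven k : M := \sum_b k 0 b *: (qf b *m (qf b)^T).
Definition Kodd a : M := \sum_b a 0 b *: (sf b *m (qf b)^T).

Lemma Keven_linear : linear Keven.
Proof.
move=> c k k'; rewrite scaler_sumr -big_split; apply: eq_bigr => b _ /=.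
by rewrite !mxE scalerDl scalerA.
Qed.

Lemma Kodd_linear : linear Kodd.
Proof.
move=> c k k'; rewrite scaler_sumr -big_split; apply: eq_bigr => b _ /=.
by rewrite !mxE scalerDl scalerA.
Qed.

HB.instance Definition _ := GRing.isLinear.Build _ _ _ _ Keven Keven_linear.
HB.instance Definition _ := GRing.isLinear.Build _ _ _ _ Kodd Kodd_linear.

Definition Kjoint (y : 'rV[R]_(nb + nb)) : M := Keven (lsubmx y) + Kodd (rsubmx y).

Lemma Kjoint_linear : linear Kjoint.
Proof. by move=> c y y'; rewrite /Kjoint !linearP /= scalerDr addrACA. Qed.

HB.instance Definition _ := GRing.isLinear.Build _ _ _ _ Kjoint Kjoint_linear.

Lemma KffE k a : Kff net k a = Keven k + Kodd a.
Proof.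
rewrite -big_split /=; apply/matrixP => i j; rewrite mxE !summxE.
apply: eq_bigr => b _; rewrite !mxE !big_ord1 !mxE.
ring.
Qed.

Lemma Keven_tr k : (Keven k)^T = Keven k.
Proof.
rewrite /Keven linear_sum; apply: eq_bigr => b _.
by rewrite linearZ /= trmx_mul trmxK.
Qed.

Lemma Cmx_even_tr k : (Cmx net k 0)^T = Cmx net k 0.
Proof. by rewrite /Cmx trmx_inv KffE linear0 addr0 Keven_tr. Qed.

(** Symmetry of C at a = 0 turns q_b^T C into (C q_b)^T = w_b^T. *)
Lemma Cmx_odd_Cmx k a :
  Cmx net k 0 *m Kodd a *m Cmx net k 0 =
  \sum_b a 0 b *: (zb net k 0 b *m (wb net k 0 b)^T).
Proof.
rewrite /Kodd mulmx_sumr mulmx_suml; apply: eq_bigr => b _.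
by rewrite -scalemxAr -scalemxAl /zb /wb trmx_mul Cmx_even_tr !mulmxA.
Qed.

End NetworkStiffness.

(** * Shared antisymmetric block of the response and its derivatives *)

Section NetworkResponse.
Variables (R : realType) (N nb : nat) (net : network R N nb).
Variables (S T : {set 'I_(nfree net)}).
Local Notation M := 'M[R]_(nfree net).
Implicit Types (k a : 'rV[R]_nb) (b : 'I_nb).

Definition resp_block (X : M) : 'M[R]_(#|T|, #|S|) := mxsub enum_val enum_val X.

Lemma resp_block_linear : linear resp_block.
Proof. by move=> c X Y; apply/matrixP => i j; rewrite !mxE. Qed.

HB.instance Definition _ :=
  GRing.isLinear.Build _ _ _ _ resp_block resp_block_linear.

Local Notation ablock := (anti_block (@tau _ _ _ net S T) (@sigma _ _ _ net S T)).
Local Notation aproj := (anti_proj (@tau _ _ _ net S T) (@sigma _ _ _ net S T)).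

Lemma tau_inj : injective (@tau _ _ _ net S T).
Proof. exact: sub_pos_inj. Qed.

Lemma sigma_inj : injective (@sigma _ _ _ net S T).
Proof. exact: sub_pos_inj. Qed.

Lemma symPE : @symP _ _ _ net S T = block_sym (@tau _ _ _ net S T) (@sigma _ _ _ net S T).
Proof.
apply/seteqP; split=> A sA; rewrite /block_sym /symP /= in sA *.
  by apply/matrixP => r c; rewrite !mxE sA subrr.
by move=> r c; move/matrixP/(_ r c)/eqP : sA; rewrite !mxE subr_eq0 => /eqP.
Qed.

Lemma antiPE : antiP S T = [set A | aproj A = A].
Proof. by rewrite /antiP symPE orthoc_block_sym //; [exact: tau_inj|exact: sigma_inj]. Qed.

Lemma antirespE k a : antiresp S T k a = aproj (resp S T k a).
Proof. by rewrite /antiresp /antiP symPE oproj_anti //; [exact: tau_inj|exact: sigma_inj]. Qed.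

(** [tau] and [sigma] locate the same degree of freedom in T and in S, so the shared block is a
    principal submatrix of X. *)
Lemma anti_block_resp (X : M) : ablock (resp_block X) =
  mxsub enum_val enum_val X - (mxsub enum_val enum_val X)^T.
Proof. by apply/matrixP => i j; rewrite !mxE !sub_posE. Qed.

Lemma anti_block_resp_sym (X : M) : X^T = X -> ablock (resp_block X) = 0.
Proof.
move=> sX; rewrite anti_block_resp; apply/matrixP => i j; rewrite !mxE.
by rewrite -[in X in _ - X]sX mxE subrr.
Qed.

Lemma anti_block_odd k a :
  ablock (resp_block (Cmx net k 0 *m Kodd net a *m Cmx net k 0)) =
  \sum_b a 0 b *: zw_wedge S T k 0 b.
Proof.
rewrite Cmx_odd_Cmx anti_block_resp; apply/matrixP => i j.
rewrite !mxE !summxE -sumrB; apply: eq_bigr => b _.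
by rewrite !mxE !big_ord1 !mxE; ring.
Qed.

(** Reciprocity: a stiffness change keeps C dK C symmetric. *)
Lemma anti_block_even k l :
  ablock (resp_block (Cmx net k 0 *m Keven net l *m Cmx net k 0)) = 0.
Proof.
by apply: anti_block_resp_sym; rewrite !trmx_mul Cmx_even_tr Keven_tr mulmxA.
Qed.

End NetworkResponse.

(** * Surjectivity of the differentials and the conclusions *)

Section Corollary.
Variables (R : realType) (N nb : nat) (net : network R N nb).
Variables (S T : {set 'I_(nfree net)}) (k0 : 'rV[R]_nb).
Hypothesis k0_adm : admissible net k0 0.
Hypothesis wedges_span : forall M : 'M[R]_#|shared S T|,
  (M \in <<[seq zw_wedge S T k0 0 b | b <- enum 'I_nb]>>%VS) = (M^T == - M).

Local Notation ablock := (anti_block (@tau _ _ _ net S T) (@sigma _ _ _ net S T)).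
Local Notation aproj := (anti_proj (@tau _ _ _ net S T) (@sigma _ _ _ net S T)).
Local Notation Rb := (@resp_block _ _ _ net S T).
Local Notation y0 := (row_mx k0 0).

Lemma row_coord_continuous n (j : 'I_n) : continuous (fun y : 'rV[R]_n => y 0 j).
Proof. by move=> y; exact: coord_continuous. Qed.

Lemma antirespF :
  antiresp S T k0 = inv_affine (Keven net k0) (Kodd net) (aproj \o Rb).
Proof. by apply/funext => a; rewrite antirespE /resp /Cmx KffE. Qed.

Lemma resp2F : resp2 S T = inv_affine 0 (Kjoint net) Rb.
Proof.
by apply/funext => y; rewrite /resp2 /resp /Cmx KffE /inv_affine add0r.
Qed.

Lemma unit_odd : Keven net k0 + Kodd net 0 \in unitmx.
Proof. by rewrite -KffE; exact: k0_adm.2. Qed.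

Lemma unit_joint : 0 + Kjoint net y0 \in unitmx.
Proof. by rewrite add0r /Kjoint row_mxKl row_mxKr unit_odd. Qed.

Lemma near_admissible_odd : nbhs 0 [set a | admissible net k0 a].
Proof.
have := near_affine_unit unit_odd; apply: filterS => a ua.
by split; [exact: k0_adm.1|rewrite KffE].
Qed.

Lemma near_admissible_joint : nbhs y0 (admissible2 net).
Proof.
near=> y; split=> [b|]; last first.
  rewrite KffE -[X in X \in _]add0r -/(Kjoint net y).
  by near: y; apply: near_affine_unit; exact: unit_joint.
rewrite mxE; move: b; near: y; apply: filter_forall => b.
have := @row_coord_continuous _ (lshift nb b) y0.
move=> /cvgr_gt; apply.
by rewrite row_mxEl; exact: k0_adm.1.
Unshelve. all: by end_near. Qed.

Lemma dodd_aproj v : aproj (dinv_affine (Keven net k0) (Kodd net) Rb 0 v) =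
  dinv_affine (Keven net k0) (Kodd net) (aproj \o Rb) 0 v.
Proof. by rewrite /dinv_affine linearN. Qed.

Lemma ablock_dodd v :
  ablock (dinv_affine (Keven net k0) (Kodd net) (aproj \o Rb) 0 v) =
  - \sum_b v 0 b *: zw_wedge S T k0 0 b.
Proof.
rewrite -dodd_aproj anti_block_proj; [|exact: tau_inj|exact: sigma_inj].
by rewrite /dinv_affine linearN /= -KffE anti_block_odd.
Qed.

(** A matrix fixed by the projection is determined by its antisymmetric block; the minus sign in the
    couplings cancels the one in - C dK C. *)
Lemma dodd_onto (c : 'I_nb -> R) w :
  aproj w = w -> ablock w = \sum_b c b *: zw_wedge S T k0 0 b ->
  dinv_affine (Keven net k0) (Kodd net) (aproj \o Rb) 0 (\row_b - c b) = w.
Proof.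
move=> pw bw; set D := dinv_affine _ _ _ _ _.
have pD : aproj D = D.
  by rewrite /D -dodd_aproj anti_projK; [|exact: tau_inj|exact: sigma_inj].
rewrite -pD -pw /anti_proj bw ablock_dodd -sumrN.
by congr (_ *: block_embed _ _ _); apply: eq_bigr => b _; rewrite mxE scaleNr opprK.
Qed.

(** A free family as large as the bound of [dim_anti_le] fills the whole antisymmetric space. *)
Lemma free_wedges_span (B : {set 'I_nb}) (M : 'M[R]_#|shared S T|) :
  #|B| = #|upper_pairs #|shared S T| | ->
  free [seq zw_wedge S T k0 0 b | b <- enum B] -> M^T = - M ->
  M \in <<[seq zw_wedge S T k0 0 b | b <- enum B]>>%VS.
Proof.
move=> cardB freeB aM; set X := [seq _ | b <- enum B].
pose V := <<[seq zw_wedge S T k0 0 b | b <- enum 'I_nb]>>%VS.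
have sXV : (<<X>> <= V)%VS.
  by apply: sub_span => _ /mapP[b _ ->]; rewrite map_f // mem_enum.
have dV : (\dim V <= #|upper_pairs #|shared S T| |)%N.
  by apply: dim_anti_le => M'; rewrite wedges_span => /eqP.
have : (<<X>> == V)%VS.
  by rewrite eqEdim sXV (eqP freeB) size_map -cardE cardB.
by move=> /eqP ->; rewrite wedges_span aM.
Qed.

Lemma dodd_onto_span w : aproj w = w ->
  exists v, dinv_affine (Keven net k0) (Kodd net) (aproj \o Rb) 0 v = w.
Proof.
move=> pw; have : ablock w \in <<[seq zw_wedge S T k0 0 b | b <- enum 'I_nb]>>%VS.
  by rewrite wedges_span anti_block_tr.
move=> /span_map_sum[c _ bw]; exists (\row_b - c b).
exact: dodd_onto.
Qed.

Lemma antiresp_submersion :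
  submersion_at [set a | admissible net k0 a] (antiresp S T k0) (antiP S T) 0 /\
  locally_onto [set a | admissible net k0 a] (antiresp S T k0) (antiP S T) 0.
Proof.
rewrite antirespF antiPE; apply: inv_affine_submersion.
- exact: unit_odd.
- exact: near_admissible_odd.
- by move=> X /=; rewrite anti_projK; [|exact: tau_inj|exact: sigma_inj].
- exact: dodd_onto_span.
- by move=> X /=; rewrite anti_projK; [|exact: tau_inj|exact: sigma_inj].
Qed.

Lemma antiresp0 : antiresp S T k0 0 = 0.
Proof.
rewrite antirespE /anti_proj anti_block_resp_sym ?linear0 ?scaler0 //.
exact: Cmx_even_tr.
Qed.

Lemma antiresp_supported_onto (B : {set 'I_nb}) :
  #|B| = #|upper_pairs #|shared S T| | ->
  free [seq zw_wedge S T k0 0 b | b <- enum B] ->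
  forall eps : R, 0 < eps -> exists2 delta : R, 0 < delta &
    forall A, antiP S T A -> `|A| < delta ->
      exists a : 'rV[R]_nb, [/\ `|a| < eps, (forall b, b \notin B -> a 0 b = 0),
        admissible net k0 a & antiresp S T k0 a = A].
Proof.
move=> cardB freeB eps eps0.
(* Masking the parameter inside Lam keeps the general result applicable on the full row space, while
   the coupling actually used, y times the mask, vanishes off B. *)
pose mask : 'rV[R]_nb := \row_b (b \in B)%:R.
pose Lam : {linear 'rV[R]_nb -> 'M[R]_(nfree net)} :=
  Kodd net \o mulmxr (diag_mx mask).
have maskE (y : 'rV[R]_nb) b : (y *m diag_mx mask) 0 b = y 0 b * (b \in B)%:R.
  by rewrite mul_mx_diag !mxE.
have Lam0 : Lam 0 = Kodd net 0 by rewrite !linear0.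
have uA : Keven net k0 + Lam 0 \in unitmx by rewrite Lam0 unit_odd.
have /nbhs_normP[e1 /= e10 e1P] := near_admissible_odd.
have e0 : 0 < Num.min eps e1 by rewrite lt_min eps0.
have piZ X : aproj ((aproj \o Rb) X) = (aproj \o Rb) X.
  by rewrite /= anti_projK; [|exact: tau_inj|exact: sigma_inj].
have piK (X : 'M[R]_(#|T|, #|S|)) : aproj (aproj X) = aproj X.
  by rewrite anti_projK; [|exact: tau_inj|exact: sigma_inj].
have onto w : aproj w = w ->
    exists v, dinv_affine (Keven net k0) Lam (aproj \o Rb) 0 v = w.
  move=> pw; have := free_wedges_span cardB freeB
    (anti_block_tr (@tau _ _ _ net S T) (@sigma _ _ _ net S T) w).
  move=> /span_map_sum[c c0 bw]; exists (\row_b - c b).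
  rewrite -[RHS](dodd_onto pw bw) /dinv_affine Lam0.
  (* The preimage is already supported on B, so the mask does not change it. *)
  suff -> : Lam (\row_b - c b) = Kodd net (\row_b - c b) by [].
  congr (Kodd net _); apply/rowP => b; rewrite maskE mxE.
  by case: (boolP (b \in B)) => bB; rewrite ?mulr1// c0 ?oppr0 ?mul0r// mem_enum.
have [d d0 dP] := inv_affine_onto uA piZ onto piK e0.
exists d => // A; rewrite antiPE => pA Ad.
have fE y : inv_affine (Keven net k0) Lam (aproj \o Rb) y =
    antiresp S T k0 (y *m diag_mx mask) by rewrite antirespF.
have [|y] := dP A pA; first by rewrite fE mul0mx antiresp0 subr0.
rewrite subr0 lt_min => /andP[y_eps y_e1] yA.
have le_y : `|y *m diag_mx mask| <= `|y|.
  apply/mx_norm_leP => // i j; rewrite ord1 maskE normrM.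
  rewrite (le_trans _ (mx_norm_ge y 0 j)) //.
  by case: (j \in B); rewrite ?normr1 ?normr0 ?mulr1 ?mulr0.
exists (y *m diag_mx mask); split.
- exact: le_lt_trans y_eps.
- by move=> b bB; rewrite maskE (negbTE bB) mulr0.
- by apply: e1P => /=; rewrite sub0r normrN (le_lt_trans le_y).
- by rewrite -fE.
Qed.

Lemma jacobian_joint v :
  v *m 'J (fun y => mxvec (resp2 S T y)) y0 =
  mxvec (dinv_affine 0 (Kjoint net) Rb y0 v).
Proof.
(* With [mxvec] absorbed into Z the map is again an [inv_affine]. *)
have -> : (fun y => mxvec (resp2 S T y)) =
    inv_affine 0 (Kjoint net) (mxvec \o Rb) by rewrite resp2F.
rewrite mul_rV_lin1 (inv_affine_diff _ unit_joint).2.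
by rewrite /dinv_affine /= linearN.
Qed.

Lemma jacobian_even v :
  v *m 'J (fun k => mxvec (resp S T k 0)) k0 =
  mxvec (dinv_affine 0 (Keven net) Rb k0 v).
Proof.
have -> : (fun k => mxvec (resp S T k 0)) =
    inv_affine 0 (Keven net) (mxvec \o Rb).
  by apply/funext => k; rewrite /resp /Cmx KffE linear0 addr0 /inv_affine add0r.
have uk : 0 + Keven net k0 \in unitmx.
  by have := unit_odd; rewrite linear0 addr0 add0r.
rewrite mul_rV_lin1 (inv_affine_diff _ uk).2.
by rewrite /dinv_affine /= linearN.
Qed.

Lemma djoint_even v : dinv_affine 0 (Kjoint net) Rb y0 (row_mx v 0) =
  dinv_affine 0 (Keven net) Rb k0 v.
Proof.
by rewrite /dinv_affine !add0r /= /Kjoint !row_mxKl !row_mxKr !linear0 !addr0.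
Qed.

Lemma djoint_odd v : dinv_affine 0 (Kjoint net) Rb y0 (row_mx 0 v) =
  dinv_affine (Keven net k0) (Kodd net) Rb 0 v.
Proof.
by rewrite /dinv_affine !add0r /= /Kjoint !row_mxKl !row_mxKr (linear0 (Keven net)) add0r.
Qed.

(** Rank-nullity for rho on the row space of J: the odd couplings supply the whole image of rho, the
    stiffnesses supply the kernel part. *)
Lemma rank_joint :
  \rank ('J (fun k => mxvec (resp S T k 0)) k0) =
    (#|T| * #|S| - #|upper_pairs #|shared S T| |)%N ->
  \rank ('J (fun y => mxvec (resp2 S T y)) y0) = (#|T| * #|S|)%N.
Proof.
set Jk := 'J _ _; set J := 'J _ _ => rk.
pose rho : 'M[R]_(#|T| * #|S|, #|upper_pairs #|shared S T| |) :=
  lin1_mx (@upper _ R \o ablock \o vec_mx).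
have rhoE w : mxvec w *m rho = upper (ablock w) by rewrite mul_rV_lin1 /= mxvecK.
have Jk_ker : (Jk <= J :&: kermx rho)%MS.
  apply/rV_subP => _ /submxP[v ->]; rewrite sub_capmx; apply/andP; split.
    apply/submxP; exists (row_mx v 0).
    by rewrite jacobian_joint djoint_even jacobian_even.
  apply/sub_kermxP; rewrite jacobian_even rhoE /dinv_affine linearN /=.
  have -> : invmx (0 + Keven net k0) = Cmx net k0 0.
    by rewrite /Cmx KffE linear0 addr0 add0r.
  by rewrite anti_block_even oppr0 linear0.
have Jrho : row_full (J *m rho).
  rewrite -sub1mx; apply/rV_subP => t _.
  have : of_upper t \in <<[seq zw_wedge S T k0 0 b | b <- enum 'I_nb]>>%VS.
    by rewrite wedges_span of_upper_anti.
  (* Negated wedge coefficients, used as odd couplings with the stiffnesses fixed, give a preimage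
     of t. *)
  move=> /span_map_sum[c _ tE]; apply/submxP; exists (row_mx 0 (\row_b - c b)).
  rewrite mulmxA jacobian_joint rhoE djoint_odd /dinv_affine linearN /=.
  rewrite -KffE anti_block_odd -sumrN -[LHS]upper_ofK tE; congr (upper _).
  by apply: eq_bigr => b _; rewrite mxE scaleNr opprK.
(* The rank of J is that of J rho, which is full, plus that of J within the kernel of rho, which is
   at least the rank of Jk. *)
apply/eqP; rewrite eqn_leq rank_leq_col -(mxrank_mul_ker J rho).
rewrite (eqP Jrho) -leq_subLR -rk; exact: mxrankS.
Qed.

Lemma resp2_submersion :
  \rank ('J (fun y => mxvec (resp2 S T y)) y0) = (#|T| * #|S|)%N ->
  submersion_at (admissible2 net) (resp2 S T) [set: 'M[R]_(#|T|, #|S|)] y0 /\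
  locally_onto (admissible2 net) (resp2 S T) [set: 'M[R]_(#|T|, #|S|)] y0.
Proof.
move=> rJ.
(* The target is the full matrix space, so the projection is the identity. *)
have -> : [set: 'M[R]_(#|T|, #|S|)] = [set w | idfun w = w].
  by apply/seteqP; split.
rewrite resp2F; apply: inv_affine_submersion => //.
- exact: unit_joint.
- exact: near_admissible_joint.
move=> w _; have : (mxvec w <= 'J (fun y => mxvec (resp2 S T y)) y0)%MS.
  by apply: submx_full; rewrite /row_full rJ.
move=> /submxP[v]; rewrite jacobian_joint => /(can_inj mxvecK) ->.
by exists v.
Qed.

End Corollary.

Theorem corollary17 (R : realType) (N nb : nat) (net : network R N nb)
    (S T : {set 'I_(nfree net)}) (k0 : 'rV[R]_nb)
    (k0_adm : admissible net k0 0)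
    (wedges_span : forall M : 'M[R]_#|shared S T|,
      (M \in <<[seq zw_wedge S T k0 0 b | b <- enum 'I_nb]>>%VS) = (M^T == - M)) :
  let p := #|shared S T| in
  let F := antiresp S T k0 in
  let D := [set a | admissible net k0 a] in
  let rank_k := \rank ('J (fun k => mxvec (resp S T k 0)) k0) in
  let rank_ka := \rank ('J (fun y => mxvec (resp2 S T y)) (row_mx k0 0)) in
  [/\ F 0 = 0,
      submersion_at D F (antiP S T) 0 /\
        locally_onto D F (antiP S T) 0,
      (forall B : {set 'I_nb},
        #|B| = ((p * (p - 1)) %/ 2)%N ->
        free [seq zw_wedge S T k0 0 b | b <- enum B] ->
        forall eps : R, 0 < eps -> exists2 delta : R, 0 < delta &
          forall A, antiP S T A -> `|A| < delta ->
            exists a : 'rV[R]_nb,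
              [/\ `|a| < eps, (forall b, b \notin B -> a 0 b = 0),
                  admissible net k0 a & F a = A]),
      (rank_k = (#|T| * #|S| - (p * (p - 1)) %/ 2)%N ->
        rank_ka = (#|T| * #|S|)%N) &
      (rank_ka = (#|T| * #|S|)%N ->
        submersion_at (admissible2 net) (resp2 S T)
          [set: 'M[R]_(#|T|, #|S|)] (row_mx k0 0) /\
        locally_onto (admissible2 net) (resp2 S T)
          [set: 'M[R]_(#|T|, #|S|)] (row_mx k0 0))].
Proof.
move=> p F D rank_k rank_ka; rewrite /rank_k /rank_ka -card_upper_pairs.
split.
- exact: antiresp0.
- exact: antiresp_submersion.
- by move=> B; exact: antiresp_supported_onto.
- exact: rank_joint.
- exact: resp2_submersion.
Qed.
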